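(* Let $H$ be a finite capable group and let $r=\mathrm{rk}(H')$. Then $|H:Z(H)|\leq |H'|^{4r}$.
   Context: A group $H$ is capable if there exists some group $G$ such that $G/Z(G)$ is isomorphic to $H$. $H'$ is the derived (commutator) subgroup of $H$ and $Z(H)$ its centre. The rank $\mathrm{rk}(K)$ of a finite group $K$ is the minimal number $r$ such that every subgroup of $K$ can be generated by $r$ elements. *)

(* Defs.v *)
From HB Require Import structures.
From mathcomp Require Import all_boot all_fingroup all_solvable.
From mathcomp Require Import boolp.

Set Implicit Arguments.
Unset Strict Implicit.
Unset Printing Implicit Defensive.

Local Open Scope group_scope.
Local Open Scope quotient_scope.

(* fingroup and quotient only deal with finite groups, whereas the group G
   witnessing capability may be infinite; so Z(G) and G / Z(G) are built here
   for an arbitrary groupType. Membership in Z(G) is made boolean by the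
   classical `[< _ >]; by the same axioms, the choiceType structure contained in
   a groupType excludes no group. *)
Section CentralQuotient.
Variable G : groupType.

Definition centre : {pred G} := [pred z | `[< forall x : G, commute z x >]].

Lemma centreP (z : G) : reflect (forall x, commute z x) (z \in centre).
Proof. exact: asboolP. Qed.

Lemma centre1 : 1 \in centre.
Proof. by apply/centreP => x; exact/commute_sym/commute1. Qed.

Lemma centreM (y z : G) : y \in centre -> z \in centre -> y * z \in centre.
Proof.
move=> /centreP cy /centreP cz; apply/centreP => x.
by apply/commute_sym/commuteM; apply/commute_sym.
Qed.

Lemma centreV (z : G) : z \in centre -> z^-1 \in centre.
Proof.
by move=> /centreP cz; apply/centreP => x; apply/commute_sym/commuteV/commute_sym.
Qed.

Definition same_coset : rel G := [rel x y | x^-1 * y \in centre].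

Lemma same_coset_refl : reflexive same_coset.
Proof. by move=> x; rewrite /same_coset /= mulVg centre1. Qed.

Lemma same_coset_sym : symmetric same_coset.
Proof.
have imp x y : same_coset x y -> same_coset y x.
  by move=> /centreV; rewrite invgM invgK.
by move=> x y; apply/idP/idP; apply: imp.
Qed.

Lemma same_coset_trans : transitive same_coset.
Proof.
move=> y x z xy yz; have := centreM xy yz.
by rewrite -mulgA mulKVg.
Qed.

Canonical same_coset_equiv :=
  EquivRel same_coset same_coset_refl same_coset_sym same_coset_trans.

Definition central_quotient := {eq_quot same_coset}.

HB.instance Definition _ := EqQuotient.on central_quotient.
HB.instance Definition _ := Choice.on central_quotient.

Definition cq_one : central_quotient := \pi_central_quotient 1.
Definition cq_mul (a b : central_quotient) : central_quotient :=
  \pi_central_quotient (generic_quotient.repr a * generic_quotient.repr b).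
Definition cq_inv (a : central_quotient) : central_quotient :=
  \pi_central_quotient (generic_quotient.repr a)^-1.

Lemma cq_eqP (x y : G) :
  reflect (\pi_central_quotient x = \pi_central_quotient y)
          (x^-1 * y \in centre).
Proof. exact: (@eqmodP _ same_coset_equiv). Qed.

Lemma repr_piP (x : G) : x^-1 * generic_quotient.repr (\pi_central_quotient x) \in centre.
Proof. by apply/cq_eqP; rewrite reprK. Qed.

Lemma cq_mulE (x y : G) :
  cq_mul (\pi_central_quotient x) (\pi_central_quotient y) =
  \pi_central_quotient (x * y).
Proof.
apply/esym/cq_eqP; have zx := repr_piP x; have zy := repr_piP y.
set x' := generic_quotient.repr _ in zx *; set y' := generic_quotient.repr _ in zy *.
have -> : (x * y)^-1 * (x' * y') = (x^-1 * x') * (y^-1 * y').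
  by rewrite invgM -!mulgA (mulgA x^-1) (mulgA _ y^-1) ((centreP _ zx) y^-1) !mulgA.
exact: centreM.
Qed.

Lemma cq_invE (x : G) :
  cq_inv (\pi_central_quotient x) = \pi_central_quotient x^-1.
Proof.
apply/esym/cq_eqP; have zx := repr_piP x; set x' := generic_quotient.repr _ in zx *.
suff -> : x^-1^-1 * x'^-1 = (x^-1 * x')^-1 by exact: centreV.
apply: (mulIg x); rewrite invgK -mulgA.
by have /centreP/(_ x) := centreV zx; rewrite invgM invgK; apply: esym.
Qed.

Lemma cq_mulA : associative cq_mul.
Proof.
elim/quotW=> x; elim/quotW=> y; elim/quotW=> z.
by rewrite (cq_mulE y z) (cq_mulE x y) (cq_mulE x) (cq_mulE _ z) mulgA.
Qed.

Lemma cq_mul1 : left_id cq_one cq_mul.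
Proof. by elim/quotW=> x; rewrite (cq_mulE 1 x) mul1g. Qed.

Lemma cq_mulr1 : right_id cq_one cq_mul.
Proof. by elim/quotW=> x; rewrite (cq_mulE x 1) mulg1. Qed.

Lemma cq_mulV : left_inverse cq_one cq_inv cq_mul.
Proof. by elim/quotW=> x; rewrite (cq_invE x) (cq_mulE _ _) mulVg. Qed.

Lemma cq_mulrV : right_inverse cq_one cq_inv cq_mul.
Proof. by elim/quotW=> x; rewrite (cq_invE x) (cq_mulE _ _) mulgV. Qed.

HB.instance Definition _ :=
  isGroup.Build central_quotient cq_mulA cq_mul1 cq_mulr1 cq_mulV cq_mulrV.

End CentralQuotient.

Definition isomorphic (G K : groupType) : Prop :=
  exists f : {multiplicative G -> K}, bijective f.

Definition capable (gT : finGroupType) (H : {group gT}) : Prop :=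
  exists G : groupType, isomorphic (central_quotient G) (subg_of H).

Section Rank.
Variable gT : finGroupType.

(* An r-tuple of generators may repeat elements, hence <= r. *)
Definition generated_by (r : nat) (L : {set gT}) : bool :=
  [exists B : {set gT}, (#|B| <= r) && (<<B>> == L)].

Definition subgroups_generated_by (K : {group gT}) : pred nat :=
  fun r => [forall (L : {group gT} | L \subset K), generated_by r L].

Lemma ex_subgroups_generated_by (K : {group gT}) :
  exists r, subgroups_generated_by K r.
Proof.
exists #|K|; apply/'forall_implyP => L sLK; apply/existsP; exists (L : {set gT}).
by rewrite subset_leq_card //= genGid.
Qed.

(* Not mathcomp's 'r(K), which only involves elementary abelian subgroups. *)
Definition rk (K : {group gT}) : nat := ex_minn (ex_subgroups_generated_by K).

End Rank.

(* Main.v *)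
From HB Require Import structures.
Require Import Defs.
From mathcomp Require Import all_boot all_fingroup all_solvable.
From mathcomp Require Import boolp.

Set Implicit Arguments.
Unset Strict Implicit.
Unset Printing Implicit Defensive.

(** Write N for the derived subgroup of H, n for #|N|, r for its rank, and
    choose pi : G ->> H with kernel 'Z(G). Since H is G / 'Z(G), an element of
    H is trivial as soon as its lifts to G commute with all of G; this is the
    only trace that capability leaves, and it is recorded by the relation
    [lifts_commute] on H.

    Suppose first that N is a p-group. By Burnside's basis theorem r
    commutators [~ g_i, h_i] generate N. If c in H commutes with the 2r
    elements g_i and h_i, then conjugation by a lift of c multiplies lifts of
    g_i and h_i by central elements, hence fixes their commutators
    ([lifts_commute_commg]): lifts of c commute with lifts of all of N. For
    such a c there is a symmetry between g and x ([lifts_commute_commgl]): if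
    c commutes with x, then lifts of [~ c, g] and of x commute, whatever g is.
    As [~ c, g] lies in 'Z(N), it remains to pick elements x such that only 1
    in 'Z(N) has lifts commuting with the lifts of all the chosen x. The socle
    of 'Z(N) has order at most p ^ r, so a descending chain argument
    ([few_in_bigcap]) shows that r elements suffice. So 3r elements of H have
    their common centraliser contained in 'Z(H), and the centraliser of x
    has index at most n, because the class of x is contained in the coset
    of N by x.

    For general N the argument is run for each prime p separately, inside
    'C_H(N), which has index at most n ^ r. There c |-> [~ c, x] is a morphism
    to the abelian group 'Z(N), and the condition that c commutes with x is
    weakened to: the p-part of [~ c, x] vanishes, or equivalently
    [~ c, x] ^+ n`_p^' = 1. This costs an index of at most n`_p only
    ([commg_power_kernel]), and the argument above applied to c ^+ n`_p^'
    shows that 3r conditions of this kind force the p-part of every [~ c, g]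
    to vanish ([p_part_test_set]). Imposing them for all primes p makes c
    central, at the cost of an index of at most the product of the
    n`_p ^ (3 * r), that is n ^ (3 * r); with the factor n ^ r this is
    n ^ (4 * r) ([index_center_leq]). *)

Local Open Scope group_scope.

(** * Indices of intersections *)

Section Index.
Variables (gT : finGroupType).
Implicit Types C D E : {group gT}.

Lemma index_setI_leq C D E : #|C : D :&: E| <= #|C : D| * #|C : E|.
Proof.
rewrite -(indexgI C (D :&: E)) setIA.
rewrite -(@Lagrange_index _ C (C :&: D) (C :&: D :&: E)) ?subsetIl //.
by rewrite !indexgI leq_mul ?leqnn // subset_leq_card ?imsetS ?subsetIl.
Qed.

Lemma index_bigcap_leq C (I : finType) (P : pred I) (D : I -> {group gT}) :
  #|C : \bigcap_(i | P i) D i| <= \prod_(i | P i) #|C : D i|.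
Proof.
(* Being a group is carried along the fold, since index_setI_leq needs it. *)
suff /andP[]: group_set (\bigcap_(i | P i) D i) &&
   (#|C : \bigcap_(i | P i) D i| <= \prod_(i | P i) #|C : D i|) by [].
elim/big_rec2: _ => [|i k K _ /andP[gK le_k]].
  rewrite groupP /= (eqP (_ : #|C : setT| == 1%N)) //.
  by rewrite (indexg_eq1 C [set: gT]%G) subsetT.
rewrite (group_setI (D i) (group gK)) /=.
apply: leq_trans (index_setI_leq C (D i) (group gK)) _.
by rewrite leq_mul2l le_k orbT.
Qed.
End Index.

(** * Selecting few members of a family, by chains in p-groups *)

Section Few.
Variables (gT : finGroupType).

(** As long as some F i cuts V down properly, intersecting V with it lowers
    the exponent of #|V|, which can happen at most r times. *)
Lemma few_in_bigcap (I : finType) (F : I -> {group gT}) (S : {set I}) (p r : nat)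
    (V : {group gT}) :
  p.-group V -> logn p #|V| <= r ->
  exists X : {set I}, [/\ X \subset S, #|X| <= r &
    V :&: \bigcap_(i in X) F i \subset \bigcap_(i in S) F i].
Proof.
elim: r V => [|r IHr] V pV leVr.
  exists set0; split; rewrite ?sub0set ?cards0 //.
  have -> : V :=: 1.
    by apply/eqP; move: leVr; rewrite leqn0 trivg_card1 {2}(card_pgroup pV) => /eqP->.
  apply: (subset_trans (subsetIl _ _)).
  by apply/bigcapsP => i _; rewrite sub1G.
have [sVF | nsVF] := boolP (V \subset \bigcap_(i in S) F i).
  by exists set0; rewrite sub0set cards0 subIset ?sVF.
have [i Si nsVi]: exists2 i, i \in S & ~~ (V \subset F i).
  apply/exists_inP; apply: contraR nsVF => /exists_inPn nF.
  by apply/bigcapsP => i /nF; rewrite negbK.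
have [||X [sXS leX sXF]] := IHr (V :&: F i)%G; first exact: pgroupS (subsetIl _ _) pV.
  rewrite -ltnS; apply: leq_trans leVr; apply: properG_ltn_log => //.
  by rewrite /proper subsetIl subsetI subxx.
exists (i |: X); split.
- by rewrite subUset sub1set Si.
- by rewrite cardsU1 (leq_add (leq_b1 _)).
- by apply: subset_trans sXF; rewrite /= -setIA setIS // bigcap_setU big_set1.
Qed.

(** The dual chain argument: adjoining to U a generator outside U raises the
    exponent of #|U|. *)
Lemma few_generators_mod (I : finType) (f : I -> gT) (S : {set I}) (p r : nat)
    (P U : {group gT}) :
  p.-group P -> <<f @: S>> = P -> U \subset P ->
  logn p #|P| <= r + logn p #|U| ->
  exists X : {set I}, [/\ X \subset S, #|X| <= r & U <*> <<f @: X>> = P].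
Proof.
move=> pP genP; elim: r U => [|r IHr] U sUP lePUr.
  exists set0; split; rewrite ?sub0set ?cards0 // imset0 gen0 joingG1.
  apply/eqP; rewrite eqEproper sUP /=; apply: contraL lePUr => /(properG_ltn_log pP).
  by rewrite -ltnNge.
have [sfU | /subsetPn[_ /imsetP[i Si ->] nUi]] := boolP (f @: S \subset U).
  exists set0; split; rewrite ?sub0set ?cards0 // imset0 gen0 joingG1.
  by apply/eqP; rewrite eqEsubset sUP -genP gen_subG.
have Pi : f i \in P by rewrite -genP mem_gen ?imset_f.
have sU'P : U <*> <[f i]> \subset P by rewrite join_subG sUP cycle_subG.
have [||X [sXS leX genX]] := IHr (U <*> <[f i]>)%G => //.
  apply: (leq_trans lePUr); rewrite addSn -addnS leq_add2l.
  apply: properG_ltn_log; first exact: pgroupS sU'P pP.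
  by rewrite /proper joing_subl join_subG subxx cycle_subG.
exists (i |: X); split.
- by rewrite subUset sub1set Si.
- by rewrite cardsU1 (leq_add (leq_b1 _)).
- rewrite imsetU1 -genX /= -joingA; congr (_ <*> _).
  by rewrite joing_idl joing_idr joingE.
Qed.

Lemma logn_abelem_generated p r (V : {group gT}) (B : {set gT}) :
  p.-abelem V -> <<B>> = V -> #|B| <= r -> logn p #|V| <= r.
Proof.
move=> aV gB; apply: leq_trans.
by rewrite -(rank_abelem aV) -grank_abelian ?(abelem_abelian aV) // -gB grank_min.
Qed.
End Few.

(** Burnside's basis theorem in N modulo its p'-elements: these generate a
    normal subgroup K for which N / K is a p-group, and r of the given
    generators suffice for N / K modulo its Frattini subgroup. *)
Lemma few_generators_up_to_p' (gT : finGroupType) (I : finType) (f : I -> gT)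
    (S : {set I}) (p r : nat) (N : {group gT}) (B : {set gT}) :
  <<f @: S>> = N -> <<B>> = N -> #|B| <= r ->
  exists X : {set I}, [/\ X \subset S, #|X| <= r &
    forall F : {group gT}, {in N, forall y, p^'.-elt y -> y \in F} ->
      f @: X \subset F -> N \subset F].
Proof.
move=> genS genB leBr.
pose K := <<[set y in N | p^'.-elt y]>>%G.
have p'K y : y \in N -> p^'.-elt y -> y \in K.
  by move=> Ny p'y; rewrite mem_gen // inE Ny.
have nKN : N \subset 'N(K).
  apply/norms_gen/subsetP => g Ng; rewrite inE.
  apply/subsetP => _ /imsetP[y yA ->]; move: yA; rewrite !inE => /andP[Ny p'y].
  by rewrite groupJ // p_eltJ.
have pP : p.-group (N / K).
  rewrite -pnat_exponent; apply: pnat_dvd (part_pnat p #|N|).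
  apply/exponentP => _ /morphimP[y Ky Ny ->]; rewrite -morphX //.
  apply: coset_id; rewrite -(consttC p y) expgMn; last exact: commuteX2.
  have yp : y.`_p ^+ #|N|`_p = 1.
    by apply/eqP; rewrite -order_dvdn order_constt partn_dvd ?order_dvdG.
  by rewrite yp mul1g groupX // p'K ?p_elt_constt // groupX.
pose fK i := coset K (f i).
have nK (A : {set gT}) : A \subset N -> A \subset 'N(K).
  by move=> sAN; exact: subset_trans nKN.
have sSN : f @: S \subset N by rewrite -genS subset_gen.
have imf (X : {set I}) : X \subset S -> f @: X / K = fK @: X.
  move=> sXS; have nKX : f @: X \subset 'N(K).
    by apply: nK; apply: subset_trans sSN; apply: imsetS.
  by rewrite /quotient morphimEsub // -imset_comp.
have genf : <<fK @: S>> = N / K by rewrite -imf // -quotient_gen ?genS ?nK.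
have genb : <<B / K>> = N / K.
  by rewrite -quotient_gen ?genB // nK // -genB subset_gen.
have [|X [sXS leX genX]] := few_generators_mod (r := r) pP genf (Phi_sub _).
  rewrite -(Lagrange (Phi_sub (N / K))) lognM // addnC leq_add2r.
  rewrite -card_quotient ?gFnorm //.
  apply: (@logn_abelem_generated _ p r _ (B / K / 'Phi(N / K))).
  - exact: Phi_quotient_abelem.
  - rewrite -quotient_gen ?genb //; apply: subset_trans (gFnorm _ (N / K)).
    by rewrite (subset_trans (subset_gen _)) //= genb.
  - apply: leq_trans leBr; apply: leq_trans (leq_morphim _ _) _.
    exact: leq_morphim.
exists X; split=> // F p'F fXF.
have {}genX := Phi_nongen genX.
have sKF : K \subset F.
  by rewrite gen_subG; apply/subsetP=> y; rewrite inE => /andP[]; apply: p'F.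
by rewrite -(quotientSGK nKN sKF) -genX !gen_subG -(imf X sXS) quotientS.
Qed.

(** * Commutators and central elements in arbitrary groups *)

Section CentralCommutators.
Variable G : groupType.
Implicit Types x y z g c : G.

Definition central z := forall y, commute z y.

Lemma commMz x y z : central z -> [~ x * z, y] = [~ x, y].
Proof.
move=> cz; rewrite /commg /conjg invgM -(mulgA x) (cz y); apply: (mulgI z).
by rewrite -(mulgA z^-1) mulVKg (cz (_ * _)) !mulgA.
Qed.

Lemma commgMz x y z : central z -> [~ x, y * z] = [~ x, y].
Proof. by move=> cz; rewrite -invgR commMz // invgR. Qed.

Lemma commXz x y m : central [~ x, y] -> [~ x ^+ m, y] = [~ x, y] ^+ m.
Proof.
move=> cz; rewrite commgEl conjXg -(mulKVg x (x ^ y)) -commgEl expgMn ?mulKg //.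
exact/commute_sym/cz.
Qed.

Lemma commgXz x y m : central [~ x, y] -> [~ x, y ^+ m] = [~ x, y] ^+ m.
Proof.
move=> cz; rewrite -invgR commXz; first by rewrite -expVgn invgR.
by move=> w; rewrite -invgR; apply/commute_sym/commuteV/commute_sym/cz.
Qed.

(** Let c commute with every commutator, and put z := [~ c, x], which is
    central. Then [~ c, g] ^ x = [~ c z, g [~ g, x]] = [~ c, g] ^ [~ g, x],
    and this is [~ c, g] because both c and c ^ g commute with commutators. *)
Lemma commute_commg c g x : (forall u v, commute c [~ u, v]) ->
  central [~ c, x] -> commute [~ c, g] x.
Proof.
move=> cG' cz; apply/commgP/conjg_fixP.
have e u : u ^ x = u * [~ u, x] by rewrite mulKVg.
have cJ u v : c ^ [~ u, v] = c by apply/conjg_fixP/commgP/cG'.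
rewrite conjRg (e c) (e g) commMz // commgEl conjgM.
have -> : c^-1 = c^-1 ^ [~ g, x] by rewrite conjVg cJ.
rewrite -conjMg -commgEl; apply/conjg_fixP/commgP.
have cgG' u v : commute (c ^ g) [~ u, v].
  rewrite -(conjgKV g [~ u, v]) conjRg; apply/commgP.
  by rewrite -conjRg conjg_eq1; apply/commgP.
apply/commute_sym/commuteM; last exact/commute_sym.
exact/commuteV/commute_sym.
Qed.
End CentralCommutators.

(** * Commuting lifts to a central extension *)

Section CentralExtension.
Variables (gT : finGroupType) (H : {group gT}).
Variables (G : groupType) (pi : UMagmaMorphism.type G gT).
Hypothesis pi_H : forall x, pi x \in H.
Hypothesis pi_onto : forall h, h \in H -> exists x, pi x = h.
Hypothesis ker_pi : forall x, pi x = 1 <-> central x.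

(** The kernel of pi is central, so whether lifts of a and b commute depends
    on a and b only ([lifts_commuteP]). *)
Definition lifts_commute a b :=
  `[< forall x y, pi x = a -> pi y = b -> commute x y >].

Lemma pi_eq x x' : pi x = pi x' -> exists2 z, x' = x * z & central z.
Proof.
move=> e; exists (x^-1 * x'); first by rewrite mulKVg.
by apply/ker_pi; rewrite gmulfM gmulfV e mulVg.
Qed.

Lemma lifts_commuteP x y : reflect (commute x y) (lifts_commute (pi x) (pi y)).
Proof.
apply: (iffP (asboolP _)) => [|cxy x' y']; first exact.
move=> /esym/pi_eq[z -> cz] /esym/pi_eq[t -> ct].
apply: commuteM; last exact/commute_sym/ct.
by apply/commute_sym/commuteM; apply/commute_sym; [|apply: cz].
Qed.

Lemma lifts_commuteC a b : lifts_commute a b = lifts_commute b a.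
Proof. by apply/asboolP/asboolP => c x y ax cy; apply/commute_sym/c. Qed.

(** The image in H of the centraliser in G of a lift of a. *)
Definition lift_cent a := [set b in H | lifts_commute a b].

Lemma lift_cent_group_set a : group_set (lift_cent a).
Proof.
apply/group_setP; split=> [|b b']; rewrite !inE.
  rewrite group1; apply/asboolP => x y _ y1.
  by apply/commute_sym; move: x; apply/ker_pi.
case/andP=> /pi_onto[z <-] /asboolP czx /andP[Hb' /asboolP cb'x].
rewrite groupM //; apply/asboolP => x y xa y_eq.
rewrite -(mulVKg z y); apply: commuteM; first exact: czx.
by apply: cb'x => //; rewrite gmulfM gmulfV y_eq mulKg.
Qed.
Canonical lift_cent_group a := group (lift_cent_group_set a).

(** Lifts of c, g and h need not commute, but conjugation by a lift of c moves
    the lifts of g and h by central factors only, which commutators ignore. *)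
Lemma lifts_commute_commg c g h : c \in H -> g \in H -> h \in H ->
  commute c g -> commute c h -> lifts_commute c [~ g, h].
Proof.
move=> /pi_onto[z <-] /pi_onto[x <-] /pi_onto[y <-] czx czy.
have kz t : commute (pi z) (pi t) -> central [~ t, z].
  by move=> czt; apply/ker_pi; rewrite gmulfR; apply/eqP/commgP/commute_sym.
rewrite -gmulfR; apply/lifts_commuteP/commute_sym/commgP/conjg_fixP.
have e t : t ^ z = t * [~ t, z] by rewrite mulKVg.
by rewrite conjRg !e commMz ?commgMz //; exact: kz.
Qed.

(** Both sides say that the m-th power of a central commutator vanishes. *)
Lemma lifts_commuteXC c y m : c \in H -> y \in H -> commute c y ->
  lifts_commute (c ^+ m) y = lifts_commute c (y ^+ m).
Proof.
move=> /pi_onto[z <-] /pi_onto[x <-] czx.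
have k : central [~ z, x] by apply/ker_pi; rewrite gmulfR; apply/eqP/commgP.
have E : [~ z ^+ m, x] = [~ z, x ^+ m] by rewrite commXz ?commgXz.
rewrite -!gmulfXn; apply/lifts_commuteP/lifts_commuteP => /commgP.
  by rewrite E => /commgP.
by rewrite -E => /commgP.
Qed.

Lemma lifts_commute_commgl e g x : e \in H -> g \in H -> x \in H ->
  {in H &, forall u v, lifts_commute e [~ u, v]} -> commute e x ->
  lifts_commute [~ e, g] x.
Proof.
move=> /pi_onto[c <-] /pi_onto[y <-] /pi_onto[z <-] cH' czx.
rewrite -gmulfR; apply/lifts_commuteP/commute_commg => [u v|].
  by apply/lifts_commuteP; rewrite gmulfR; apply: cH'.
by apply/ker_pi; rewrite gmulfR; apply/eqP/commgP.
Qed.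

Lemma lifts_commute_faithful a :
  a \in H -> {in H, forall b, lifts_commute a b} -> a = 1.
Proof. by move=> /pi_onto[x <-] c; apply/ker_pi => y; exact/lifts_commuteP/c. Qed.

Local Notation N := H^`(1).

(** The set consists of the entries g_i, h_i of r commutators that, together
    with the p'-elements, generate N, and of r elements x detecting the
    p-torsion of 'Z(N). Put m := #|N|`_p^' and e := c ^+ m, so that e commutes
    with the whole set. Then the elements of N whose lifts commute with those
    of e include the [~ g_i, h_i], and also every p'-element y of N, since by
    [lifts_commuteXC] this means that lifts of c and of y ^+ m = 1 commute;
    so they form all of N. By symmetry [~ e, g] = [~ c, g] ^+ m then lies in a
    subgroup of 'Z(N) without p-torsion, and so does [~ c, g] up to a
    p'-power. *)
Lemma p_part_test_set (p r : nat) :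
  (forall L : {group gT}, L \subset N ->
     exists2 B : {set gT}, <<B>> = L & #|B| <= r) ->
  exists X : {set gT}, [/\ X \subset H, #|X| <= 3 * r &
    forall c, c \in 'C_H(N) -> {in X, forall x, [~ c, x] ^+ (#|N|`_p^')%N = 1} ->
      {in H, forall g, p^'.-elt [~ c, g]}].
Proof.
move=> rkN; pose m := (#|N|`_p^')%N.
have [B genB leBr] := rkN _ (subxx _).
pose f (u : gT * gT) := [~ u.1, u.2].
have genf : <<f @: setX H H>> = N.
  congr <<_>>; apply/setP=> y; apply/imsetP/imset2P => [[[g h]] | [g h Hg Hh ->]].
    by case/setXP=> /= Hg Hh ->; exists g h.
  by exists (g, h); first exact/setXP.
have [X1 [sX1 leX1 X1P]] := few_generators_up_to_p' p genf genB leBr.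
pose V := 'Ohm_1('O_p('Z(N))).
have pZ : p.-group 'O_p('Z(N)) := pcore_pgroup _ _.
have aZ : abelian 'O_p('Z(N)) := abelianS (pcore_sub _ _) (center_abelian _).
have sZN : 'Z(N) \subset N := center_sub _.
have sVN : V \subset N.
  by rewrite (subset_trans (Ohm_sub _ _)) // (subset_trans (pcore_sub _ _)).
have aV : p.-abelem V := Ohm1_abelem pZ aZ.
have [C genC leCr] := rkN _ sVN.
have [X2 [sX2 leX2 X2P]] := few_in_bigcap lift_cent_group (H : {set gT})
  (abelem_pgroup aV) (logn_abelem_generated aV genC leCr).
(* Elements of V whose lifts commute with those of X2 have central lifts. *)
have tiV : V :&: \bigcap_(x in X2) lift_cent x = 1.
  apply/trivgP/(subset_trans X2P)/subsetP => a /bigcapP aF.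
  have /setIdP[Ha _] := aF 1 (group1 _).
  apply/set1P/lifts_commute_faithful => // b /aF/setIdP[_].
  by rewrite lifts_commuteC.
exists (fst @: X1 :|: snd @: X1 :|: X2); split.
- rewrite !subUset sX2 andbT; apply/andP.
  by split; apply/subsetP=> _ /imsetP[[g h] /(subsetP sX1) /setXP[Hg Hh] ->].
- rewrite (leq_trans (leq_card_setU _ _)) // mulSn addnC leq_add //.
  rewrite (leq_trans (leq_card_setU _ _)) // mul2n -addnn.
  by rewrite leq_add // (leq_trans (leq_imset_card _ _)).
move=> c /setIP[Hc cNc] cX.
have cgZ : {in H, forall g, [~ c, g] \in 'Z(N)}.
  move=> g Hg; rewrite inE mem_commg //=.
  rewrite commgEl groupM ?groupV //.
  by rewrite memJ_norm // (subsetP (norms_cent (der_norm 1 H))).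
have cXg g : g \in H -> [~ c ^+ m, g] = [~ c, g] ^+ m.
  move=> Hg; apply: commXg; apply: (centP cNc).
  by rewrite (subsetP sZN) ?cgZ.
have cX1 x : x \in fst @: X1 :|: snd @: X1 :|: X2 -> x \in H ->
    commute (c ^+ m) x.
  by move=> Xx Hx; apply/commgP; rewrite cXg // cX.
have sHm : c ^+ m \in H by rewrite groupX.
have sNc : N \subset lift_cent (c ^+ m).
  apply: X1P => [y Ny p'y|].
    have Hy : y \in H := subsetP (der_sub 1 H) y Ny.
    rewrite inE Hy lifts_commuteXC //; last exact: (centP cNc).
    suff -> : y ^+ m = 1 by have /setIdP[] := group1 (lift_cent_group c).
    by apply/eqP; rewrite -order_dvdn -(part_pnat_id p'y) partn_dvd ?order_dvdG.
  apply/subsetP => _ /imsetP[[g h] X1gh ->].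
  have /setXP[/= Hg Hh] := subsetP sX1 _ X1gh.
  rewrite inE groupR //= lifts_commute_commg //; apply: cX1 => //; rewrite !inE.
    by rewrite (imset_f fst X1gh).
  by rewrite (imset_f snd X1gh) orbT.
move=> g Hg.
have Uxg : [~ c ^+ m, g] \in 'Z(N) :&: \bigcap_(x in X2) lift_cent x.
  rewrite inE {1}cXg // groupX ?cgZ //; apply/bigcapP => x X2x.
  have Hx := subsetP sX2 _ X2x.
  rewrite inE groupR // lifts_commuteC lifts_commute_commgl //; last first.
    by apply: cX1; rewrite // inE X2x orbT.
  by move=> u v Hu Hv; have /setIdP[] := subsetP sNc _ (mem_commg Hu Hv).
apply/constt1P/eqP; set w := [~ c, g] in Uxg *.
have Zw : w \in 'Z(N) by apply: cgZ.
have wp : (w ^+ m).`_p = 1.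
  have tiU : ('Z(N) :&: \bigcap_(x in X2) lift_cent x) :&: 'O_p('Z(N)) = 1.
    by apply/TI_Ohm1/trivgP; rewrite /= -tiV setIC setIS ?subsetIr.
  have Up : (w ^+ m).`_p \in 'Z(N) :&: \bigcap_(x in X2) lift_cent x.
    by rewrite -cXg //; apply: (subsetP _ _ (cycle_constt p _)); rewrite cycle_subG.
  suff: (w ^+ m).`_p \in [1 gT] by move/set1P.
  rewrite -tiU inE Up /=.
  have hallZ := nilpotent_pcore_Hall p (abelian_nil (center_abelian N)).
  rewrite (mem_normal_Hall hallZ (pcore_normal _ _)) ?p_elt_constt //.
  by case/setIP: Up.
rewrite consttX in wp; rewrite -order_eq1 -dvdn1.
have cop : coprime #[w.`_p] m.
  exact: pnat_coprime (p_elt_constt _ _) (part_pnat _ _).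
by rewrite -(eqnP cop) dvdn_gcd dvdnn order_dvdn wp eqxx.
Qed.
End CentralExtension.

(** * Counting the conditions *)

Section CountingConditions.
Variables (gT : finGroupType) (H : {group gT}).
Local Notation N := H^`(1).

(** Elements of 'C_H(N) centralise [~ c, x], so c |-> [~ c, x] ^+ #|N|`_p^' is
    a morphism on 'C_H(N). Its kernel is the required group, and its image in
    N has exponent dividing #|N|`_p. *)
Lemma commg_power_kernel p x : x \in H ->
  exists D : {group gT}, #|'C_H(N) : D| <= (#|N|`_p)%N /\
   forall c, c \in 'C_H(N) -> c \in D -> [~ c, x] ^+ (#|N|`_p^')%N = 1.
Proof.
move=> Hx; pose m := (#|N|`_p^')%N; pose f c := [~ c, x] ^+ m.
have Nx c : c \in H -> [~ c, x] \in N by move=> Hc; rewrite mem_commg.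
have Cx c : c \in 'C(N) -> [~ c, x] \in 'C(N).
  move=> cNc; rewrite groupM ?groupV // memJ_norm //.
  by rewrite (subsetP (norms_cent (der_norm 1 H))).
have fM : {in 'C_H(N) &, {morph f : a b / a * b}}.
  move=> a b /setIP[Ha cNa] /setIP[Hb cNb].
  rewrite /f commMgJ (conjg_fixP _); last first.
    by apply/commgP/commute_sym; apply: (centP cNb); apply: Nx.
  by apply: expgMn; apply: commute_sym; apply: (centP (Cx _ cNb)); apply: Nx.
exists ('ker (Morphism fM))%G; split; last by move=> c _ /mker.
have imN : Morphism fM @* 'C_H(N) \subset N.
  by apply/subsetP => _ /morphimP[c _ /setIP[Hc _] ->] /=; rewrite groupX ?Nx.
have imp : p.-group (Morphism fM @* 'C_H(N)).
  rewrite -pnat_exponent; apply: pnat_dvd (part_pnat p #|N|).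
  apply/exponentP => _ /morphimP[c _ /setIP[Hc _] ->] /=.
  by rewrite /f -expgnA mulnC partnC // expg_cardG ?Nx.
have := card_morphim (Morphism fM) 'C_H(N); rewrite setIid => <-.
by rewrite -(part_pnat_id imp) dvdn_leq ?part_gt0 // partn_dvd ?cardSg.
Qed.

(** For b in N the class of b under H lies in N, so 'C_H[b] has index at most
    #|N|. *)
Lemma index_cent_leq r (B : {set gT}) : <<B>> = N -> #|B| <= r ->
  #|H : 'C_H(N)| <= #|N| ^ r.
Proof.
move=> genB leBr; rewrite indexgI /= -{1}genB cent_gen.
have -> : 'C(B) = \bigcap_(b in B) 'C[b].
  by apply/setP=> x; apply/centP/bigcapP => cB b /cB /cent1P.
apply: leq_trans (index_bigcap_leq _ _ (fun b => 'C[b]%G)) _.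
apply: leq_trans (leq_pexp2l (cardG_gt0 N) leBr).
rewrite -prod_nat_const; apply: leq_prod => b Bb.
have Nb : b \in N by rewrite -genB mem_gen.
rewrite -indexgI index_cent1 subset_leq_card //.
by rewrite class_sub_norm // der_norm.
Qed.

(** Imposing on c in 'C_H(N) the conditions attached to a prime p costs an
    index of at most #|N|`_p ^ (3 * r); all of them together leave no prime
    that could divide the order of a commutator [~ c, g]. *)
Lemma index_center_leq r (B : {set gT}) : <<B>> = N -> #|B| <= r ->
  (forall p, prime p -> exists X : {set gT}, [/\ X \subset H, #|X| <= 3 * r &
    forall c, c \in 'C_H(N) -> {in X, forall x, [~ c, x] ^+ (#|N|`_p^')%N = 1} ->
      {in H, forall g, p^'.-elt [~ c, g]}]) ->
  #|H : 'Z(H)| <= #|N| ^ (4 * r).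
Proof.
move=> genB leBr tests; set n := #|N|; have n_gt0 : 0 < n := cardG_gt0 _.
have Dp (p : 'I_n.+1) : exists D : {group gT},
    (p : nat) \in \pi(n) -> #|'C_H(N) : D| <= (n`_p ^ (3 * r))%N /\
      (forall c, c \in 'C_H(N) -> c \in D ->
         {in H, forall g, p^'.-elt [~ c, g]}).
  have [pin | nin] := boolP ((p : nat) \in \pi(n)); last by exists 1%G => /idPn.
  have [|X [sXH leX XP]] := tests p.
    by move: pin; rewrite mem_primes => /andP[].
  have Ex x : exists D : {group gT}, x \in H -> #|'C_H(N) : D| <= n`_p /\
     (forall c, c \in 'C_H(N) -> c \in D -> [~ c, x] ^+ n`_p^' = 1).
    have [Hx | nHx] := boolP (x \in H); last by exists 1%G => /idPn.
    by have [D DP] := commg_power_kernel p Hx; exists D.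
  have [D DP] := fin_all_exists Ex.
  exists (\bigcap_(x in X) D x)%G => _; split.
    apply: leq_trans (index_bigcap_leq _ _ _) _.
    apply: leq_trans (leq_pexp2l (part_gt0 _ _) leX).
    rewrite -prod_nat_const; apply: leq_prod => x /(subsetP sXH) Hx.
    by case: (DP x Hx).
  move=> c Cc /bigcapP Dc; apply: XP => // x Xx.
  by case: (DP x (subsetP sXH x Xx)) => _; apply; last exact: Dc.
have [D DP] := fin_all_exists Dp.
pose E := \bigcap_(p : 'I_n.+1 | (p : nat) \in \pi(n)) D p.
have sEZ : 'C_H(N) :&: E \subset 'Z(H).
  apply/subsetP => c /setIP[Cc /bigcapP Ec].
  have Hc : c \in H by case/setIP: Cc.
  rewrite inE Hc; apply/centP => g Hg; apply/commgP.
  rewrite -order_eq1; apply: contraT => w1.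
  have q_pr : prime (pdiv #[[~ c, g]]).
    by rewrite pdiv_prime // ltn_neqAle eq_sym w1 order_gt0.
  have q_dv := pdiv_dvd #[[~ c, g]]; set q := pdiv _ in q_pr q_dv.
  have qn : q %| n by apply/(dvdn_trans q_dv)/order_dvdG/mem_commg.
  have lt_qn : q < n.+1 by rewrite ltnS dvdn_leq ?n_gt0.
  have qpi : (Ordinal lt_qn : nat) \in \pi(n) by rewrite mem_primes q_pr n_gt0.
  have [_ /(_ c Cc (Ec _ qpi) g Hg)] := DP _ qpi.
  by rewrite /p_elt p'natE ?q_dv.
apply: (@leq_trans #|H : 'C_H(N) :&: E|).
  exact/dvdn_leq/indexgS.
rewrite -(@Lagrange_index _ H 'C_H(N) ('C_H(N) :&: E)%G) ?subsetIl //.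
rewrite mulSn expnD leq_mul ?(index_cent_leq genB) // indexgI.
apply: leq_trans (index_bigcap_leq _ _ _) _.
apply: (@leq_trans
  (\prod_(p : 'I_n.+1 | (p : nat) \in \pi(n)) n`_p ^ (3 * r))%N).
  by apply: leq_prod => p pin; case: (DP p pin).
rewrite -(big_morph (expn^~ (3 * r)%N) (fun a b => expnMn a b _) (exp1n _)).
rewrite (_ : \prod_(p < n.+1 | _) _ = n)%N ?leqnn //.
rewrite -[RHS](partn_pi n_gt0) [in RHS]/partn big_mkord.
by apply: eq_bigr => p _; rewrite p_part.
Qed.
End CountingConditions.

(** * Capable groups *)

(** The quotient map G ->> G / 'Z(G), followed by the isomorphism to H. *)
Lemma capable_central_quotient (gT : finGroupType) (H : {group gT}) :
  capable H -> exists (G : groupType) (pi : UMagmaMorphism.type G gT),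
    [/\ forall x, pi x \in H, forall h, h \in H -> exists x, pi x = h &
        forall x, pi x = 1 <-> central x].
Proof.
case=> G [f [f' fK f'K]]; exists G.
pose cq (x : G) : central_quotient G := (\pi_(central_quotient G) x)%qT.
have cqM : {morph cq : x y / x * y} by move=> x y; rewrite /cq -cq_mulE.
pose q x := sgval (f (cq x)).
have qM : {morph q : x y / x * y} by move=> x y; rewrite /q cqM gmulfM.
have q1 : q 1 = 1 by apply: (mulgI (q 1)); rewrite -qM !mulg1.
pose pi : UMagmaMorphism.type G gT :=
  HB.pack q (isMultiplicative.Build _ _ q qM)
            (Multiplicative_isUMagmaMorphism.Build _ _ q q1).
exists pi; split=> [x | h Hh | x].
- exact: subgP.
- exists (generic_quotient.repr (f' (Sub h Hh))).
  by rewrite /= /q /cq generic_quotient.reprK f'K.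
- rewrite /= -q1; split=> [/subg_inj/(can_inj fK)/esym/cq_eqP | cx].
    by rewrite invg1 mul1g => /centreP.
  by congr (sgval (f _)); apply/esym/cq_eqP; rewrite invg1 mul1g; apply/centreP.
Qed.

Lemma rk_generators (gT : finGroupType) (K L : {group gT}) :
  L \subset K -> exists2 B : {set gT}, <<B>> = L & #|B| <= rk K.
Proof.
move=> sLK; rewrite /rk; case: ex_minnP => r /'forall_implyP/(_ L sLK) /existsP[B].
by case/andP=> leB /eqP genB _; exists B.
Qed.

Local Close Scope group_scope.

Theorem corollary4 (gT : finGroupType) (H : {group gT}) :
  capable H ->
  #|H : 'Z(H)|%g <= #|H^`(1)%g| ^ (4 * rk H^`(1)%G).
Proof.
case/capable_central_quotient=> G [pi [pi_H pi_onto ker_pi]].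
have rkN := @rk_generators _ (H^`(1)%G).
have [B genB leB] := rkN _ (subxx _).
apply: index_center_leq genB leB _ => p _.
exact: (p_part_test_set pi_H pi_onto ker_pi).
Qed.
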